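(* Let $n\in\mathbb{N}$, let $E=E(\mathbb{R}^n)$ and $X=X(\mathbb{R}^n)$ be rearrangement-invariant spaces with Luxemburg representations $\widetilde{E}(0,\infty)$, $\widetilde{X}(0,\infty)$, and let $\Phi\in B_n(\infty)$. Then the embedding $K_3\mapsto\widetilde{X}(0,\infty)$ holds if and only if the operator $T_\Phi$ is bounded from $\widetilde{E}(0,\infty)$ to $\widetilde{X}(0,\infty)$, i.e. there is $C>0$ with $\|T_\Phi f\|_{\widetilde{X}}\le C\|f\|_{\widetilde{E}}$ for all $f\in\widetilde{E}(0,\infty)$, where $(T_\Phi f)(x)=\sup_{x<t<\infty}\Phi(t^{1/n})\,t\,f^{**}(t)$.
   Context: A rearrangement-invariant space (RIS) on $\mathbb{R}^n$ is a Banach function space (Bennett–Sharpley) with respect to Lebesgue measure whose norm satisfies $\|f\|\le\|g\|$ whenever $f^*\le g^*$; $f^*(t)=\inf\{y>0:|\{|f|>y\}|\le t\}$, $f^{**}(t)=\frac1t\int_0^tf^*$. The Luxemburg representation $\widetilde{X}(0,\infty)$ of $X$ is the RIS on $(0,\infty)$ with $\|f\|_X=\|f^*\|_{\widetilde{X}}$ (similarly $\widetilde{E}$). Class $B_n(\infty)$: $\Phi:(0,\infty)\to(0,\infty)$ decreasing and continuous with $\int_0^r\Phi(\rho)\rho^{n-1}d\rho\le C\Phi(r)r^n$ for all $r>0$, some $C>0$. $K_3=\{h:\ h(t)=\sup_{t<\tau<\infty}\tau\Phi(\tau^{1/n})u^{**}(\tau)\ \forall t>0,\text{ for some }u\in E\}$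 with $\rho_{K_3}(h)=\inf\{\|u\|_E:\ u\in E,\ \sup_{t<\tau<\infty}\tau\Phi(\tau^{1/n})u^{**}(\tau)=h(t)\ \forall t>0\}$. The embedding $K_3\mapsto\widetilde{X}$ means $K_3\subset\widetilde{X}$ and $\|h\|_{\widetilde{X}}\le C\rho_{K_3}(h)$ for all $h\in K_3$. *)

(* Defs.v *)
From HB Require Import structures.
From mathcomp Require Import all_boot all_order all_algebra.
From mathcomp Require Import all_classical all_reals all_analysis measurable_realfun.
Unset Printing Implicit Defensive.
Import Order.TTheory GRing.Theory Num.Theory.
Import numFieldNormedType.Exports.
Local Open Scope classical_set_scope.
Local Open Scope ring_scope.
Local Open Scope ereal_scope.

Section Defs.
Variable R : realType.
Implicit Types (n : nat).

Definition pos : set R := `]0%R, +oo[.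

(** Decreasing rearrangement w.r.t. a measure [mu] of a function restricted
    to a set [D]:  f^*(t) = inf { y > 0 : mu (D ∩ {|f| > y}) <= t }
    (inf of the empty set = +oo). *)
Definition dstar (T : Type) (mu : set T -> \bar R) (D : set T)
    (f : T -> \bar R) (t : R) : \bar R :=
  ereal_inf [set y%:E | y in
    [set y : R | (0 < y)%R /\ mu (D `&` [set x | y%:E < `|f x|]) <= t%:E]].

(** f^**(t) = (1/t) \int_0^t f^*(s) ds, for a nonnegative function
    g = f^* on (0,oo). *)
Definition dstarstar (g : R -> \bar R) (t : R) : \bar R :=
  (t^-1)%:E * \int[@lebesgue_measure R]_(s in `]0%R, t[) g s.

Definition rstar (f : R -> \bar R) : R -> \bar R :=
  dstar R (@lebesgue_measure R) pos f.

Definition supop (n : nat) (Phi : R -> R) (g : R -> \bar R) (x : R) : \bar R :=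
  ereal_sup [set ((Phi (t `^ (n%:R)^-1)) * t)%:E * g t | t in `]x, +oo[].

Definition T_Phi (n : nat) (Phi : R -> R) (f : R -> \bar R) : R -> \bar R :=
  supop n Phi (dstarstar (rstar f)).

Definition B_n_infty (n : nat) (Phi : R -> R) : Prop :=
  (forall r, (0 < r)%R -> (0 < Phi r)%R) /\
  (forall r s, (0 < r)%R -> (r <= s)%R -> (Phi s <= Phi r)%R) /\
  {within pos, continuous Phi} /\
  exists C : R, (0 < C)%R /\ forall r, (0 < r)%R ->
    \int[@lebesgue_measure R]_(rho in `]0%R, r[) (Phi rho * rho ^+ n.-1)%:E
      <= (C * Phi r * r ^+ n)%:E.

Definition box (n : nat) (a b : 'rV[R]_n) : set 'rV[R]_n :=
  [set x | forall i, (a ord0 i <= x ord0 i)%R /\ (x ord0 i <= b ord0 i)%R].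

Definition vol (n : nat) (a b : 'rV[R]_n) : R :=
  (\prod_(i < n) Num.max 0 (b ord0 i - a ord0 i))%R.

Definition lebesgue_n (n : nat) (A : set 'rV[R]_n) : \bar R :=
  ereal_inf [set \sum_(0 <= k <oo) (vol n (ab.1 k) (ab.2 k))%:E |
    ab in [set ab : (nat -> 'rV[R]_n) * (nat -> 'rV[R]_n) |
           A `<=` \bigcup_k box n (ab.1 k) (ab.2 k)]].

Definition Lmeasurable (n : nat) (A : set 'rV[R]_n) : Prop :=
  forall S, lebesgue_n n S = lebesgue_n n (S `&` A) + lebesgue_n n (S `&` ~` A).

Definition Lmeasurable_fun (n : nat) (u : 'rV[R]_n -> \bar R) : Prop :=
  forall y : R, Lmeasurable n [set x | y%:E < u x].

Definition rstar_n (n : nat) (u : 'rV[R]_n -> \bar R) : R -> \bar R :=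
  dstar 'rV[R]_n (@lebesgue_n n) setT u.

(** ---- Banach function norms on (0,oo) (Bennett--Sharpley (P1)-(P5)),
         rearrangement-invariant ---- *)
Definition mplus (f : R -> \bar R) : Prop :=
  measurable_fun pos f /\ forall x, pos x -> 0 <= f x.

Definition is_ri_function_norm (rho : (R -> \bar R) -> \bar R) : Prop :=
  let mu := @lebesgue_measure R in
  (forall f, mplus f -> 0 <= rho f) /\
  (forall f, mplus f ->
     (rho f = 0 <-> {ae mu, forall x, pos x -> f x = 0})) /\
  (forall f (a : R), mplus f -> (0 <= a)%R ->
     rho (fun x => a%:E * f x) = a%:E * rho f) /\
  (forall f g, mplus f -> mplus g -> rho (f \+ g) <= rho f + rho g) /\
  (forall f g, mplus f -> mplus g ->
     {ae mu, forall x, pos x -> g x <= f x} -> rho g <= rho f) /\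
  (forall (F : nat -> R -> \bar R) f, (forall k, mplus (F k)) -> mplus f ->
     {ae mu, forall x, pos x ->
        {homo (fun k => F k x) : i j / (i <= j)%N >-> i <= j} /\
        ((fun k => F k x) @ \oo --> f x)} ->
     (fun k => rho (F k)) @ \oo --> rho f) /\
  (forall A, measurable A -> A `<=` pos -> mu A < +oo ->
     rho (fun x => (\1_A x)%:E) < +oo) /\
  (forall A, measurable A -> A `<=` pos -> mu A < +oo ->
     exists C : R, forall f, mplus f ->
       \int[mu]_(x in A) f x <= C%:E * rho f) /\
  (forall f g, mplus f -> mplus g ->
     (forall t, (0 < t)%R -> rstar f t <= rstar g t) -> rho f <= rho g).

Definition in_space (rho : (R -> \bar R) -> \bar R) (f : R -> \bar R) : Prop :=
  measurable_fun pos f /\ rho (abse \o f) < +oo.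

(** The space E on R^n whose Luxemburg representation has function norm
    rhoE:  ||u||_E = rhoE(u^* ),  E = {u Lebesgue measurable : ||u||_E < oo}. *)
Definition normE_n (n : nat) (rhoE : (R -> \bar R) -> \bar R)
    (u : 'rV[R]_n -> \bar R) : \bar R := rhoE (rstar_n n u).

Definition in_E_n (n : nat) (rhoE : (R -> \bar R) -> \bar R)
    (u : 'rV[R]_n -> \bar R) : Prop :=
  Lmeasurable_fun n u /\ normE_n n rhoE u < +oo.

Definition K3_fun (n : nat) (Phi : R -> R) (u : 'rV[R]_n -> \bar R) : R -> \bar R :=
  supop n Phi (dstarstar (rstar_n n u)).

Definition in_K3 (n : nat) (rhoE : (R -> \bar R) -> \bar R) (Phi : R -> R)
    (h : R -> \bar R) : Prop :=
  exists u, in_E_n n rhoE u /\ forall t, (0 < t)%R -> h t = K3_fun n Phi u t.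

Definition rho_K3 (n : nat) (rhoE : (R -> \bar R) -> \bar R) (Phi : R -> R)
    (h : R -> \bar R) : \bar R :=
  ereal_inf [set normE_n n rhoE u | u in
    [set u | in_E_n n rhoE u /\ forall t, (0 < t)%R -> K3_fun n Phi u t = h t]].

Definition K3_embeds (n : nat) (rhoE rhoX : (R -> \bar R) -> \bar R)
    (Phi : R -> R) : Prop :=
  exists C : R, (0 < C)%R /\ forall h, in_K3 n rhoE Phi h ->
    in_space rhoX h /\ rhoX (abse \o h) <= C%:E * rho_K3 n rhoE Phi h.

Definition T_Phi_bounded (n : nat) (rhoE rhoX : (R -> \bar R) -> \bar R)
    (Phi : R -> R) : Prop :=
  exists C : R, (0 < C)%R /\ forall f, in_space rhoE f ->
    in_space rhoX (T_Phi n Phi f) /\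
    rhoX (abse \o T_Phi n Phi f) <= C%:E * rhoE (abse \o f).

End Defs.

(* Main.v *)
(** Both conditions only see [f] and [u] through their rearrangements, and
    [T_Phi f] coincides with the function of [K_3] attached to [u] as soon as
    [f^* = u^*].  If [u] is given, take [f = u^*], since [( u^* )^* = u^*].  If
    [f] is given, put [u x = f^*(x_n)] on the slab [[0,1]^(n-1) x (0,oo)] and
    [u x = 0] elsewhere: the superlevel sets of [u] are boxes whose volume is
    the length of the corresponding superlevel sets of [f^*]. *)
Require Import Defs.
From mathcomp Require Import all_boot all_order all_algebra.
From mathcomp Require Import all_classical all_reals all_analysis measurable_realfun.
From mathcomp Require Import lra.
Set Implicit Arguments.
Unset Strict Implicit.
Unset Printing Implicit Defensive.
Import Order.TTheory GRing.Theory Num.Theory.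
Import numFieldNormedType.Exports.
Local Open Scope classical_set_scope.
Local Open Scope ring_scope.
Local Open Scope ereal_scope.

Arguments dstar {R T} mu D f t.
Arguments rstar {R} f.
Arguments box {R n} a b.
Arguments vol {R n} a b.
Arguments lebesgue_n {R n} A.
Arguments Lmeasurable {R n} A.
Arguments rstar_n {R n} u.

(** * Decreasing rearrangements and the functionals built on them *)

Section Rearrangement.
Variable R : realType.
Notation leb := (@lebesgue_measure R).

Lemma posE (s : R) : pos R s = (0 < s)%R.
Proof. by rewrite /pos /= in_itv /= andbT. Qed.

Definition nonincreasing_on_pos (g : R -> \bar R) :=
  forall s t : R, (0 < s)%R -> (s <= t)%R -> g t <= g s.

Lemma superlevel_is_interval (g : R -> \bar R) (y : \bar R) :
  nonincreasing_on_pos g -> is_interval (pos R `&` [set s | y < g s]).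
Proof.
move=> g_dec a b [pa _] [pb yb] c /andP[ac cb]; rewrite posE in pa.
have c0 : (0 < c)%R by exact: lt_le_trans ac.
by split; [rewrite posE | apply: lt_le_trans yb _; exact: g_dec].
Qed.

Lemma superlevel_measurable (g : R -> \bar R) (y : \bar R) :
  nonincreasing_on_pos g -> measurable (pos R `&` [set s | y < g s]).
Proof. by move=> /superlevel_is_interval/is_interval_measurable. Qed.

Lemma nonincreasing_on_pos_measurable (g : R -> \bar R) :
  nonincreasing_on_pos g -> measurable_fun (pos R) g.
Proof.
move=> g_dec; apply: (measurability (@ErealGenOInfty.G R)).
  exact: ErealGenOInfty.measurableE.
move=> _ [_ [r ->] <-]; rewrite (_ : _ `&` _ =
    pos R `&` [set s | r%:E < g s]); first exact: superlevel_measurable.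
by apply/seteqP; split => s /= [ps]; rewrite in_itv /= andbT.
Qed.

(** Lebesgue measure is given by an outer measure on every set, so monotonicity needs no
    measurability; [rstar_dstar] asks for it on arbitrary sets. *)
Lemma le_lebesgue_measure :
  {homo (fun A => leb A) : A B / A `<=` B >-> A <= B}.
Proof.
move=> A B AB; rewrite /lebesgue_measure /lebesgue_stieltjes_measure.
by rewrite /measure_extension; exact: le_mu_ext.
Qed.

Section Dstar.
Variables (T : Type) (mu : set T -> \bar R) (D : set T).

Lemma dstar_ge0 (f : T -> \bar R) (t : R) : 0 <= dstar mu D f t.
Proof. by apply: le_ereal_inf_tmp => _ [y [y0 _] <-]; rewrite lee_fin ltW. Qed.

Lemma dstar_nonincreasing (f : T -> \bar R) (s t : R) :
  (s <= t)%R -> dstar mu D f t <= dstar mu D f s.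
Proof.
move=> st; apply: ereal_inf_le_tmp => _ [y [y0 fy] <-]; exists y => //.
by split=> //; apply: le_trans fy _; rewrite lee_fin.
Qed.

Lemma eq_dstar (f g : T -> \bar R) :
  (forall x, `|f x| = `|g x|) -> dstar mu D f = dstar mu D g.
Proof.
move=> fg; apply/funext => t; pose F (h : T -> \bar R) := ereal_inf [set y%:E |
  y in [set y : R | (0 < y)%R /\ mu (D `&` [set x | y%:E < h x]) <= t%:E]].
by apply: (congr1 F); apply/funext.
Qed.

Lemma dstar_measurable (f : T -> \bar R) :
  measurable_fun (pos R) (dstar mu D f).
Proof.
by apply: nonincreasing_on_pos_measurable => s t _; exact: dstar_nonincreasing.
Qed.

Lemma mplus_dstar (f : T -> \bar R) : mplus R (dstar mu D f).
Proof. by split=> [|x _]; [exact: dstar_measurable | exact: dstar_ge0]. Qed.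

Hypothesis mu_le : {homo mu : A B / A `<=` B >-> A <= B}.

(* For [y < z], [{f^* > y}] lies between [(0, mu {|f| > z})] and
   [(0, mu {|f| > y})], so that no continuity of [mu] is required. *)
Lemma rstar_dstar (f : T -> \bar R) (t : R) : (0 < t)%R ->
  rstar (dstar mu D f) t = dstar mu D f t.
Proof.
move=> t0; set g := dstar mu D f.
pose m (y : R) := mu (D `&` [set x | y%:E < `|f x|]).
have m_dec (y z : R) : (y <= z)%R -> m z <= m y.
  move=> yz; apply: mu_le => x [Dx fx]; split=> //=.
  by apply: le_lt_trans fx; rewrite lee_fin.
have g_dec : nonincreasing_on_pos g by move=> ? ? _; exact: dstar_nonincreasing.
have lev y : pos R `&` [set s | y%:E < `|g s|] = pos R `&` [set s | y%:E < g s].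
  by apply: eq_set => s; rewrite /= gee0_abs// dstar_ge0.
apply/eqP; rewrite eq_le; apply/andP; split.
  (* If [y] is admissible for [f] at [t], then [g <= y] from [t] on, so the superlevel set of [g]
     lies in []0, t[] and [y] is admissible for [g]. *)
  apply: ereal_inf_le_tmp => _ [y [y0 my] <-]; exists y => //; split => //.
  rewrite lev.
  have gt0E : leb `]0%R, t[%classic = t%:E.
    by rewrite lebesgue_measure_itv /= lte_fin t0 oppr0 adde0.
  rewrite -gt0E; apply: le_measure; rewrite ?inE //.
    exact: (superlevel_measurable y%:E g_dec).
  move=> s [ps /= ygs]; rewrite posE in ps; rewrite in_itv /= ps /=.
  rewrite ltNge; apply/negP => ts; move: ygs; rewrite ltNge => /negP; apply.
  apply: ereal_inf_lbound; exists y => //; split => //.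
  by apply: le_trans my _; rewrite lee_fin.
apply: le_ereal_inf_tmp => _ [y [y0 gy] <-]; rewrite lev in gy.
rewrite leNgt; apply/negP => ygt.
(* Otherwise every [y + e] would be admissible for [f] at [t], forcing [g t <= y]. *)
have [y' [yy' ty']] : exists y' : R, (y < y')%R /\ t%:E < m y'.
  apply: contrapT => H; move: ygt; rewrite ltNge => /negP; apply.
  apply/lee_addgt0Pr => e e0; apply: ereal_inf_lbound; exists (y + e)%R => //.
  split; first by rewrite addr_gt0.
  rewrite leNgt; apply/negP => mye; apply: H; exists (y + e)%R.
  by rewrite ltrDl.
have [s [ts sy']] : exists s : R, (t < s)%R /\ s%:E < m y'.
  move: ty'; case: (m y') => [r| |] //.
    rewrite lte_fin => tr; exists ((t + r) / 2)%R.
    by rewrite lte_fin midf_lt// midf_lt.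
  by move=> _; exists (t + 1)%R; rewrite ltrDl ltr01 ltry.
(* Levels admissible at [s] are at least [y']. Hence []0, s[] lies in the superlevel set of [g] at
   [y], whose measure is at most [t < s]. *)
have gs : y%:E < g s.
  apply: (@lt_le_trans _ _ y'%:E); first by rewrite lte_fin.
  apply: le_ereal_inf_tmp => _ [z [z0 mz] <-]; rewrite lee_fin leNgt.
  apply/negP => zy'; have := le_trans (m_dec _ _ (ltW zy')) mz.
  by rewrite leNgt sy'.
have : leb `]0%R, s[%classic <= t%:E.
  apply: le_trans gy; apply: le_measure; rewrite ?inE //.
    exact: (superlevel_measurable y%:E g_dec).
  move=> r /=; rewrite in_itv /= => /andP[r0 rs]; split; first by rewrite posE.
  by apply: lt_le_trans gs _; apply: g_dec => //; exact: ltW.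
rewrite lebesgue_measure_itv /= lte_fin (lt_trans t0 ts) oppr0 adde0 lee_fin.
by rewrite leNgt ts.
Qed.

End Dstar.

(** Only values on the positive half-line enter the integrals over []0, t[], and [rstar_dstar]
    provides equality exactly there. *)
Lemma eq_supop_dstarstar n (Phi : R -> R) (g1 g2 : R -> \bar R) :
  (forall t, (0 < t)%R -> g1 t = g2 t) ->
  forall x, (0 < x)%R ->
    supop R n Phi (dstarstar R g1) x = supop R n Phi (dstarstar R g2) x.
Proof.
move=> g12 x x0; rewrite /supop; congr ereal_sup; apply: eq_imagel => t /=.
rewrite in_itv /= andbT => xt; congr (_ * (_ * _)); apply: eq_integral => s.
by rewrite inE /= in_itv /= => /andP[s0 _]; exact: g12.
Qed.

(** The norm is monotone for inequalities holding almost everywhere on [pos]; using this in both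
    directions makes values at nonpositive points irrelevant. *)
Lemma in_space_eq (rho : (R -> \bar R) -> \bar R) (f g : R -> \bar R) :
  is_ri_function_norm R rho -> (forall t, (0 < t)%R -> f t = g t) ->
  in_space R rho f ->
  in_space R rho g /\ rho (abse \o f) = rho (abse \o g).
Proof.
move=> [_ [_ [_ [_ [rho_le _]]]]] fg [mf rf].
have mg : measurable_fun (pos R) g.
  by apply: eq_measurable_fun mf => t; rewrite inE posE; exact: fg.
have mplus_abs h : measurable_fun (pos R) h -> mplus R (abse \o h).
  by move=> mh; split=> [|x _ /=]; [exact: measurableT_comp | exact: abse_ge0].
have E : rho (abse \o f) = rho (abse \o g).
  apply/eqP; rewrite eq_le !rho_le//; try exact: mplus_abs;
  by apply/aeW => x /=; rewrite posE => x0; rewrite fg.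
by split=> //; split=> //; rewrite -E.
Qed.

End Rearrangement.

(** * Lebesgue outer measure in several variables and Caratheodory measurability *)

Lemma length_cut (R : realDomainType) (u v c : R) :
  (Num.max 0 (v - u) =
   Num.max 0 (Num.min v c - u) + Num.max 0 (v - Num.max u c))%R.
Proof.
have [vc|cv] := leP v c; have [uc|cu] := leP u c;
  repeat (case: leP => ?); lra.
Qed.

Section OuterLebesgue.
Variables (R : realType) (n : nat).
Notation leb := (@lebesgue_measure R).
Implicit Types (S A B : set 'rV[R]_n) (a b : nat -> 'rV[R]_n).

Definition covers S a b := S `<=` \bigcup_k box (a k) (b k).

Lemma vol_ge0 (a b : 'rV[R]_n) : (0 <= vol a b)%R.
Proof. by apply: prodr_ge0 => i _; rewrite le_max lexx. Qed.

Lemma lebesgue_n_le_cover S a b : covers S a b ->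
  lebesgue_n S <= \sum_(0 <= k <oo) (vol (a k) (b k))%:E.
Proof. by move=> Sab; apply: ereal_inf_lbound; exists (a, b). Qed.

Lemma lebesgue_n_geP S (x : \bar R) :
  (forall a b, covers S a b -> x <= \sum_(0 <= k <oo) (vol (a k) (b k))%:E) ->
  x <= lebesgue_n S.
Proof. by move=> H; apply: le_ereal_inf_tmp => _ [[a b] Sab <-]; exact: H. Qed.

Lemma lebesgue_n_le : {homo @lebesgue_n R n : A B / A `<=` B >-> A <= B}.
Proof.
move=> A B AB; apply: lebesgue_n_geP => a b Bab.
by apply: lebesgue_n_le_cover; exact: subset_trans Bab.
Qed.

Lemma lebesgue_n_ge0 S : 0 <= lebesgue_n S.
Proof.
apply: lebesgue_n_geP => a b _; apply: nneseries_ge0 => k _ _.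
by rewrite lee_fin vol_ge0.
Qed.

(** Bounds the total volume of two covers merged by parity of the index, as subadditivity requires.
    The partial sum of length [N.*2] splits exactly into the two families. *)
Lemma nneseries_interleave (f g : nat -> \bar R) :
  (forall k, 0 <= f k) -> (forall k, 0 <= g k) ->
  \sum_(0 <= k <oo) (if odd k then g k./2 else f k./2) <=
  \sum_(0 <= k <oo) f k + \sum_(0 <= k <oo) g k.
Proof.
move=> f0 g0; set h := fun k : nat => if odd k then g k./2 else f k./2.
have h0 k : 0 <= h k by rewrite /h; case: ifP.
apply: lime_le; first by apply: is_cvg_nneseries => k _ _; exact: h0.
apply: nearW => N; apply: (@le_trans _ _ (\sum_(0 <= k < N.*2) h k)).
  by apply: lee_sum_nneg_natr => [k _ _|]; [exact: h0 | rewrite -addnn leq_addr].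
have -> : \sum_(0 <= k < N.*2) h k =
    \sum_(0 <= k < N) f k + \sum_(0 <= k < N) g k.
  elim: N => [|N IH]; first by rewrite !big_geq// adde0.
  rewrite doubleS !big_nat_recr//= IH /h /= odd_double /= uphalf_double doubleK.
  by rewrite -!addeA; congr (_ + _); rewrite addeCA.
by apply: leeD; exact: nneseries_lim_ge.
Qed.

Lemma lebesgue_n_setU A B : lebesgue_n (A `|` B) <= lebesgue_n A + lebesgue_n B.
Proof.
have [->|Afin] := eqVneq (lebesgue_n A) +oo.
  by rewrite addye ?leey// gt_eqF// (lt_le_trans _ (lebesgue_n_ge0 _)).
have [->|Bfin] := eqVneq (lebesgue_n B) +oo.
  by rewrite addey ?leey// gt_eqF// (lt_le_trans _ (lebesgue_n_ge0 _)).
have fin S : lebesgue_n S != +oo -> lebesgue_n S \is a fin_num.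
  by rewrite ge0_fin_numE ?lebesgue_n_ge0// lt_neqAle leey andbT.
apply/lee_addgt0Pr => e e0.
have e20 : (0 < e / 2)%R by rewrite divr_gt0.
have [_ [[a b] Aab <-] /= ltA] := lb_ereal_inf_adherent e20 (fin _ Afin).
have [_ [[c d] Bcd <-] /= ltB] := lb_ereal_inf_adherent e20 (fin _ Bfin).
apply: (@le_trans _ _ (\sum_(0 <= k <oo) (vol (a k) (b k))%:E +
                       \sum_(0 <= k <oo) (vol (c k) (d k))%:E)); last first.
  apply: le_trans (leeD (ltW ltA) (ltW ltB)) _.
  by rewrite addeACA -EFinD -splitr.
pose p k := if odd k then c k./2 else a k./2.
pose q k := if odd k then d k./2 else b k./2.
apply: (@le_trans _ _ (\sum_(0 <= k <oo) (vol (p k) (q k))%:E)).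
  apply: lebesgue_n_le_cover => x [/Aab|/Bcd] [k _ xk].
    by exists k.*2 => //; rewrite /p /q odd_double doubleK.
  by exists k.*2.+1 => //; rewrite /p /q /= odd_double /= uphalf_double.
rewrite (eq_eseriesr (g := fun k => if odd k then (vol (c k./2) (d k./2))%:E
                             else (vol (a k./2) (b k./2))%:E)); last first.
  by move=> k _; rewrite /p /q; case: ifP.
by apply: nneseries_interleave => k; rewrite lee_fin vol_ge0.
Qed.

Lemma LmeasurableP A :
  (forall S, lebesgue_n (S `&` A) + lebesgue_n (S `&` ~` A) <= lebesgue_n S) ->
  Lmeasurable A.
Proof.
move=> H S; apply/eqP; rewrite eq_le H andbT.
by rewrite -[leLHS]/(lebesgue_n S) -{1}(setUIDK S A) lebesgue_n_setU.
Qed.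

Lemma LmeasurableC A : Lmeasurable A -> Lmeasurable (~` A).
Proof. by move=> mA S; rewrite setCK addeC. Qed.

(** [S] is cut by [A], then its part inside [A] by [B]; subadditivity reassembles the two pieces
    outside the intersection. *)
Lemma LmeasurableI A B : Lmeasurable A -> Lmeasurable B -> Lmeasurable (A `&` B).
Proof.
move=> mA mB; apply: LmeasurableP => S.
rewrite (mA S) (mB (S `&` A)) -addeA setIA leeD2l//.
apply: le_trans (lebesgue_n_setU _ _); apply: lebesgue_n_le => x [Sx].
by rewrite setCI => -[nA|nB]; [right|have [Ax|nA] := pselect (A x); [left|right]].
Qed.

Lemma Lmeasurable_bigcapI m (F : nat -> set 'rV[R]_n) :
  Lmeasurable [set: 'rV[R]_n] ->
  (forall i, Lmeasurable (F i)) ->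
  Lmeasurable [set x | forall i, (i < m)%N -> F i x].
Proof.
move=> mT mF; elim: m => [|m IH].
  by rewrite (_ : mkset _ = [set: 'rV[R]_n])//; apply/seteqP; split.
rewrite (_ : mkset _ = [set x | forall i, (i < m)%N -> F i x] `&` F m).
  exact: LmeasurableI.
apply/seteqP; split=> [x Fx|x [Fx Fmx] i]; last first.
  by rewrite ltnS leq_eqVlt => /predU1P[->//|]; exact: Fx.
by split; [move=> i im; apply: Fx; exact: ltnW | exact: Fx].
Qed.

(* Cutting every covering box along [x i = c] costs no volume: the two closed
   pieces overlap only in a face. *)
Lemma Lmeasurable_cut (i : 'I_n) (L : set R) (c : R) :
  (forall s, L s -> (s <= c)%R) -> (forall s, ~ L s -> (c <= s)%R) ->
  Lmeasurable [set x : 'rV[R]_n | L (x ord0 i)].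
Proof.
move=> Lc nLc; apply: LmeasurableP => S; apply: lebesgue_n_geP => a b Sab.
(* The hyperplane splits the box from [a] to [b] into the boxes from [a] to [lo b] and from [hi a]
   to [b]. Only factor [i] of the volume changes, and there [length_cut] applies. *)
pose lo (x : 'rV[R]_n) := \row_j if j == i then Num.min (x ord0 j) c else x ord0 j.
pose hi (x : 'rV[R]_n) := \row_j if j == i then Num.max (x ord0 j) c else x ord0 j.
have volE k : vol (a k) (b k) = (vol (a k) (lo (b k)) + vol (hi (a k)) (b k))%R.
  rewrite /vol (bigD1 i)//= [in RHS](bigD1 i)//= [X in (_ = _ + X)%R](bigD1 i)//=.
  rewrite !mxE eqxx.
  rewrite (eq_bigr (fun j => Num.max 0 (b k ord0 j - a k ord0 j))%R); last first.
    by move=> j ji; rewrite ?mxE ?(negbTE ji).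
  rewrite [in RHS](eq_bigr
    (fun j => Num.max 0 (b k ord0 j - a k ord0 j))%R); last first.
    by move=> j ji; rewrite ?mxE ?(negbTE ji).
  rewrite [X in (_ = _ + _ * X)%R](eq_bigr
    (fun j => Num.max 0 (b k ord0 j - a k ord0 j))%R); last first.
    by move=> j ji; rewrite ?mxE ?(negbTE ji).
  rewrite -mulrDl; congr (_ * _)%R.
  exact: length_cut.
rewrite (eq_eseriesr (g := fun k =>
  (vol (a k) (lo (b k)))%:E + (vol (hi (a k)) (b k))%:E)); last first.
  by move=> k _; rewrite volE.
rewrite nneseriesD; try by move=> k _ _; rewrite lee_fin vol_ge0.
apply: leeD; apply: lebesgue_n_le_cover => x [/Sab [k _ xk]] /= Lx; exists k => // j;
  have [ax xb] := xk j; rewrite !mxE; have [ji|//] := eqVneq j i.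
- by subst j; split => //; rewrite le_min xb Lc.
- by subst j; split => //; rewrite ge_max ax nLc.
Qed.

(** A down-closed set other than the empty set and the whole line is a half-line ending at [sup L];
    [Lmeasurable_cut] allows the endpoint on either side. *)
Lemma Lmeasurable_downclosed (i : 'I_n) (L : set R) :
  (forall s t, (s <= t)%R -> L t -> L s) ->
  Lmeasurable (@set0 'rV[R]_n) ->
  Lmeasurable [set x : 'rV[R]_n | L (x ord0 i)].
Proof.
move=> Ldown m0.
have [L0|/set0P [s0 Ls0]] := eqVneq L set0.
  by rewrite L0.
have [[t nLt]|/forallNP LT] := pselect (exists t, ~ L t); last first.
  rewrite (_ : mkset _ = ~` set0); first exact: LmeasurableC.
  by rewrite setC0; apply/seteqP; split => // x _; apply: contrapT; exact: LT.
have ubLt : ubound L t.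
  by move=> s Ls; rewrite leNgt; apply/negP => /ltW ts; apply: nLt; exact: Ldown Ls.
apply: (@Lmeasurable_cut i L (sup L)) => s Ls.
  by apply: ub_le_sup => //; exists t.
apply: ge_sup; first by exists s0.
by move=> r Lr; rewrite leNgt; apply/negP => /ltW sr; apply: Ls; exact: Ldown Lr.
Qed.

End OuterLebesgue.

(** * Measure of slabs over the unit cube, and transfer of functions to several variables *)

Section Slab.
Variable R : realType.
Notation leb := (@lebesgue_measure R).

Lemma lebesgue_measure_cc (a b : R) :
  leb `[a, b]%classic = (Num.max 0 (b - a))%:E.
Proof.
rewrite lebesgue_measure_itv /= lte_fin; case: ltP => ab.
  by rewrite -EFinD max_r// subr_ge0 ltW.
by rewrite max_l// subr_le0.
Qed.

(** The pointwise bound is integrated over [J] term by term; [J] meets each closed interval in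
    measure at most its length. *)
Lemma lebesgue_measure_le_cover (J : set R) (v a b : nat -> R) :
  measurable J -> (forall k, (0 <= v k)%R) ->
  (forall s, J s -> 1 <= \sum_(0 <= k <oo) (v k * \1_`[a k, b k] s)%:E) ->
  leb J <= \sum_(0 <= k <oo) (v k * Num.max 0 (b k - a k))%:E.
Proof.
move=> mJ v0 H.
have ge0 k s : 0 <= (v k * \1_`[a k, b k] s)%:E.
  by rewrite lee_fin mulr_ge0// indicE.
have mf k : measurable_fun J (fun s => (v k * \1_`[a k, b k] s)%:E).
  by apply/measurable_EFinP; apply: measurable_funM => //; exact: measurable_indic.
rewrite -[leLHS]mul1e -(integral_cst leb mJ).
apply: (@le_trans _ _ (\int[leb]_(s in J)
    \sum_(0 <= k <oo) (v k * \1_`[a k, b k] s)%:E)).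
  apply: ge0_le_integral => //.
  apply: (@ge0_emeasurable_sum _ _ _ J
    (fun k s => (v k * \1_`[a k, b k] s)%:E) xpredT) => [k s _ _|k _].
    exact: ge0.
  exact: mf.
rewrite integral_nneseries//.
apply: lee_nneseries => [k _ _|k _]; first exact: integral_ge0.
under eq_integral do rewrite EFinM.
rewrite ge0_integralZl//; last 2 first.
- by apply/measurable_EFinP; exact: measurable_indic.
- by rewrite lee_fin.
rewrite integral_indic// EFinM -lebesgue_measure_cc.
apply: lee_pmul => //; first by rewrite lee_fin.
by apply: le_measure; rewrite ?inE//; exact: measurableI.
Qed.

(* Iterated integration: the weights [w] carry the indicators of the
   coordinates that have already been frozen. *)
Lemma unit_cube_le_cover m (w : nat -> R) (a b : nat -> nat -> R) :
  (forall k, (0 <= w k)%R) ->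
  (forall x : nat -> R, (forall i, (i < m)%N -> (0 <= x i <= 1)%R) ->
    1 <= \sum_(0 <= k <oo) (w k * \prod_(i < m) \1_`[a k i, b k i] (x i))%:E) ->
  1 <= \sum_(0 <= k <oo) (w k * \prod_(i < m) Num.max 0 (b k i - a k i))%:E.
Proof.
elim: m w => [|m IH] w w0 H.
  apply: le_trans (H (fun=> 0%R) _) _ => //.
  by under eq_eseriesr do rewrite big_ord0;
     under [leRHS]eq_eseriesr do rewrite big_ord0.
under eq_eseriesr do rewrite big_ord_recr/= mulrA.
(* The constant 1 is read as the length of the range of the last coordinate, which is then
   integrated out. *)
have -> : 1 = leb `[0%R, 1%R]%classic by rewrite lebesgue_measure_cc subr0 max_r.
apply: lebesgue_measure_le_cover => // [k|s].
  by rewrite mulr_ge0// prodr_ge0// => i _; rewrite le_max lexx.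
rewrite /= in_itv /= => s01.
under eq_eseriesr do rewrite mulrAC.
apply: IH => [k|x x01]; first by rewrite mulr_ge0// indicE.
apply: le_trans (H (fun i => if (i < m)%N then x i else s) _) _ => [i|].
  by case: ifP => // im _; exact: x01.
apply: lee_nneseries => [k _ _|k _].
  by rewrite lee_fin mulr_ge0// prodr_ge0// => i _; rewrite indicE.
rewrite big_ord_recr/= ltnn lee_fin mulrA mulrAC.
by under eq_bigr => i _ do rewrite ltn_ord.
Qed.

Lemma nneseries_ge_term (f : nat -> \bar R) (k : nat) :
  (forall j, 0 <= f j) -> f k <= \sum_(0 <= j <oo) f j.
Proof.
move=> f0; apply: le_trans (nneseries_lim_ge k.+1 (fun j _ _ => f0 j)).
by rewrite big_nat_recr//= leeDr// sume_ge0.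
Qed.

Section Dim.
Variable m : nat.
Local Notation pt := 'rV[R]_m.+1.

Lemma vol_recr (a b : pt) : vol a b =
  (\prod_(i < m) Num.max 0 (b ord0 (inord i) - a ord0 (inord i)) *
   Num.max 0 (b ord0 ord_max - a ord0 ord_max))%R.
Proof.
rewrite /vol big_ord_recr /=; congr (_ * _)%R; apply: eq_bigr => i _.
rewrite (_ : widen_ord _ i = inord i)//; apply: val_inj.
by rewrite /= inordK// ltnW// ltnS.
Qed.

Definition slab (J : set R) : set pt :=
  [set x | forall i, (i < m)%N -> (0 <= x ord0 (inord i) <= 1)%R] `&`
  [set x | J (x ord0 ord_max)].

(** For fixed [s] in [J], the boxes whose last side contains [s] cover the unit cube in the other
    coordinates, so their cross-sections have total volume at least 1 by [unit_cube_le_cover].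
    Integrating in [s] gives the bound. *)
Lemma lebesgue_n_slab_ge (J : set R) :
  measurable J -> leb J <= lebesgue_n (slab J).
Proof.
move=> mJ; apply: lebesgue_n_geP => a b cov.
under eq_eseriesr do rewrite vol_recr.
apply: (@lebesgue_measure_le_cover J _ (fun k => a k ord0 ord_max)
  (fun k => b k ord0 ord_max)) => // [k|s Js].
  by rewrite prodr_ge0// => i _; rewrite le_max lexx.
under eq_eseriesr do rewrite mulrC.
apply: (@unit_cube_le_cover m _ (fun k i => a k ord0 (inord i))
  (fun k i => b k ord0 (inord i))) => [k|x x01]; first by rewrite indicE.
pose z : pt := \row_i if (i < m)%N then x i else s.
have zi i : (i < m)%N -> z ord0 (inord i) = x i.
  by move=> im; rewrite mxE inordK ?im// ltnW.
have zm : z ord0 ord_max = s by rewrite mxE /= ltnn.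
have /cov [k _ zk] : slab J z.
  by split=> [i im|]; rewrite /= ?zm// zi//; exact: x01.
set f := fun k : nat => _.
(* The single box that contains [z] already contributes 1. *)
apply: le_trans (nneseries_ge_term k _) => [|j].
  rewrite lee_fin indicE mem_set ?mul1r; last first.
    by have [? ?] := zk ord_max; rewrite /= in_itv /= -zm; apply/andP.
  rewrite big1// => i _; rewrite indicE mem_set//= in_itv /= -zi//.
  by apply/andP; exact: zk.
by rewrite lee_fin mulr_ge0// ?prodr_ge0// => *; rewrite indicE.
Qed.

(** Covers are infinite sequences, so the box is followed by copies of a degenerate box, of volume 0
    because the dimension is positive. *)
Lemma lebesgue_n_box_le (a b : pt) : lebesgue_n (box a b) <= (vol a b)%:E.
Proof.
pose c (k : nat) : pt := if k == 0%N then a else 0%R.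
pose d (k : nat) : pt := if k == 0%N then b else 0%R.
have vol00 : vol (0 : pt) 0 = 0%R by rewrite vol_recr subrr maxxx mulr0.
apply: le_trans (@lebesgue_n_le_cover _ _ _ c d _) _.
  by move=> x ?; exists 0%N.
apply: lime_le; first apply: is_cvg_nneseries => k _ _.
  by rewrite lee_fin vol_ge0.
apply: nearW => -[|N]; first by rewrite big_geq// lee_fin vol_ge0.
rewrite big_nat_recl//= big1 ?adde0// => k _.
by rewrite /c /d /= vol00.
Qed.

Lemma Lmeasurable_set0 : Lmeasurable (@set0 pt).
Proof.
have e0 : lebesgue_n (@set0 pt) = 0.
  apply/eqP; rewrite eq_le lebesgue_n_ge0 andbT.
  have := lebesgue_n_box_le 0 0; rewrite vol_recr subrr maxxx mulr0.
  by apply: le_trans; exact: lebesgue_n_le.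
by move=> S; rewrite setI0 setC0 setIT e0 add0e.
Qed.

Section Initial.
Variable J : set R.
Hypothesis J_pos : J `<=` pos R.
Hypothesis J_down : forall s t, (0 < s)%R -> (s <= t)%R -> J t -> J s.

Lemma lebesgue_n_slab : lebesgue_n (slab J) = leb J.
Proof.
have mJ : measurable J.
  apply: is_interval_measurable => s t /J_pos Js Jt r /andP[sr rt].
  by apply: J_down rt Jt; rewrite posE in Js; exact: lt_le_trans sr.
apply/eqP; rewrite eq_le lebesgue_n_slab_ge// andbT.
have : 0 <= leb J by exact: measure_ge0.
case JE : (leb J) => [r| |]; rewrite ?leey// lee_fin => r0.
(* An initial interval of measure [r] lies in []0, r]], since []0, s]] is inside [J] for each [s] in
   [J]; so the slab fits into one box of volume [r]. *)
pose e : pt := \row_i if (i < m)%N then 1%R else r.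
have vole : vol 0 e = r.
  rewrite vol_recr !mxE /= ltnn subr0 max_r// big1 ?mul1r// => i _.
  by rewrite !mxE inordK ?ltn_ord ?subr0 ?max_r// ltnW// ltnS.
rewrite -vole; apply: le_trans (lebesgue_n_box_le _ _); apply: lebesgue_n_le.
move=> x [x01 /= Jx] i; rewrite !mxE.
have [im|mi] := ltnP i m.
  by have /andP[] := x01 _ im; rewrite inord_val.
have -> : i = ord_max.
  by apply: val_inj; apply/eqP; rewrite eqn_leq mi -ltnS ltn_ord.
set s := x _ _ in Jx *; have s0 : (0 < s)%R by rewrite -posE; exact: J_pos.
split; first exact: ltW.
have : leb `]0%R, s]%classic <= leb J.
  apply: le_measure; rewrite ?inE// => t /=; rewrite in_itv /= => /andP[t0 ts].
  exact: J_down Jx.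
by rewrite JE lebesgue_measure_itv /= lte_fin s0 oppr0 adde0 lee_fin.
Qed.

Lemma Lmeasurable_slab : Lmeasurable (slab J).
Proof.
have mT : Lmeasurable [set: pt].
  by rewrite -setC0; exact: LmeasurableC Lmeasurable_set0.
have mI (i : 'I_m.+1) : Lmeasurable [set x : pt | (0 <= x ord0 i <= 1)%R].
  rewrite (_ : mkset _ = ~` [set x : pt | (x ord0 i < 0)%R] `&`
                         [set x : pt | (x ord0 i <= 1)%R]).
    apply: LmeasurableI; first apply: LmeasurableC.
      apply: (@Lmeasurable_downclosed _ _ i [set s | (s < 0)%R]);
        [by move=> s t /= /le_lt_trans; apply | exact: Lmeasurable_set0].
    apply: (@Lmeasurable_downclosed _ _ i [set s | (s <= 1)%R]);
      [by move=> s t /= /le_trans; apply | exact: Lmeasurable_set0].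
  apply/seteqP; split=> x /=; first by move=> /andP[]; rewrite leNgt => /negP.
  by move=> [/negP]; rewrite -leNgt => -> ->.
apply: (@LmeasurableI _ _ _ [set x : pt | J (x ord0 ord_max)]).
  exact: (@Lmeasurable_bigcapI _ _ m
    (fun i => [set x : pt | (0 <= x ord0 (inord i) <= 1)%R])).
have mpos : Lmeasurable (~` [set x : pt | (x ord0 ord_max <= 0)%R]).
  apply: LmeasurableC.
  apply: (@Lmeasurable_downclosed _ _ ord_max [set s | (s <= 0)%R]);
    [by move=> s t /= /le_trans; apply | exact: Lmeasurable_set0].
(* [J] is not down-closed on the whole line; adjoining the nonpositive half-line makes it so, and
   that half-line is removed again. *)
rewrite (_ : [set x : pt | J (x ord0 ord_max)] =
    ~` [set x : pt | (x ord0 ord_max <= 0)%R] `&`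
    [set x : pt | (J `|` [set s | (s <= 0)%R]) (x ord0 ord_max)]).
  apply: LmeasurableI => //.
  apply: Lmeasurable_downclosed Lmeasurable_set0 => s t st [Jt|/= t0].
    by have [s0|s0] := leP s 0%R; [right | left; exact: J_down Jt].
  by right; exact: le_trans t0.
apply/seteqP; split=> x /=.
  by move=> Jx; split; [apply/negP; rewrite -ltNge -posE; exact: J_pos | left].
by move=> [n0 []].
Qed.

End Initial.

(** The conclusion has [rstar g] and not [g], because a nonincreasing [g] without right-continuity
    need not be its own rearrangement. *)
Lemma equimeasurable_on_Rn (g : R -> \bar R) :
  nonincreasing_on_pos g -> (forall s, 0 <= g s) ->
  exists u : pt -> \bar R, Lmeasurable_fun R m.+1 u /\ rstar_n u = rstar g.
Proof.
move=> g_dec g0.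
pose u (x : pt) : \bar R := if x \in slab (pos R) then g (x ord0 ord_max) else 0.
have u0 x : 0 <= u x by rewrite /u; case: ifP.
pose J (y : R) := pos R `&` [set s | y%:E < g s].
have uJ (y : R) : (0 <= y)%R -> [set x | y%:E < u x] = slab (J y).
  move=> y0; apply/seteqP; split=> x /=; rewrite /u.
    case: ifP => [|_]; last by rewrite ltNge lee_fin y0.
    by rewrite inE => -[x01 px] ygx.
  by move=> [x01 [px ygx]]; rewrite mem_set.
have Jpos y : J y `<=` pos R by move=> s [].
have Jdown y s t : (0 < s)%R -> (s <= t)%R -> J y t -> J y s.
  move=> s0 st [_ yt]; split; first by rewrite posE.
  by apply: lt_le_trans yt _; exact: g_dec.
exists u; split=> [y|].
  have [y0|y0] := leP 0%R y; first rewrite uJ//.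
    by apply: Lmeasurable_slab => // s t; exact: Jdown.
  rewrite (_ : [set x | _] = ~` (@set0 pt)).
    exact: (LmeasurableC Lmeasurable_set0).
  by rewrite setC0; apply/seteqP; split=> // x _ /=;
    apply: lt_le_trans (u0 x); rewrite lte_fin.
apply/funext => t.
have muJ (y : R) : (0 < y)%R ->
    lebesgue_n (setT `&` [set x | y%:E < `|u x|]) =
    leb (pos R `&` [set s | y%:E < `|g s|]).
  move=> y0; under eq_set do rewrite gee0_abs//.
  rewrite setTI uJ ?ltW// lebesgue_n_slab//; last by move=> s v; exact: Jdown.
  by congr (leb (_ `&` _)); apply: eq_set => s; rewrite gee0_abs.
rewrite /rstar_n /rstar /dstar; congr (ereal_inf (image _ _)).
(* Only levels [y > 0] compete in either infimum, and for these the measures agree. *)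
by apply: eq_set => y; apply/propext; split=> -[y0 yt]; split=> //;
  rewrite ?muJ// -?muJ.
Qed.

End Dim.
End Slab.

(** * The two implications, each with the same constant *)

Section Bounded.
Variables (R : realType) (n : nat) (rhoE rhoX : (R -> \bar R) -> \bar R).
Variable Phi : R -> R.
Hypotheses (riE : is_ri_function_norm R rhoE) (riX : is_ri_function_norm R rhoX).

Lemma K3_embeds_of_T_Phi_bounded :
  T_Phi_bounded R n rhoE rhoX Phi -> K3_embeds R n rhoE rhoX Phi.
Proof.
move=> [C [C0 TC]]; exists C; split=> // h [v [Ev hv]].
have absE (u : 'rV[R]_n -> \bar R) : abse \o rstar_n u = rstar_n u.
  by apply/funext => t /=; rewrite gee0_abs// dstar_ge0.
(* The bound is proved for every [u] representing [h], since [rho_K3] is an infimum over all of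
   them. *)
have key u : in_E_n R n rhoE u ->
    (forall t, (0 < t)%R -> h t = K3_fun R n Phi u t) ->
    in_space R rhoX h /\ rhoX (abse \o h) <= C%:E * normE_n R n rhoE u.
  move=> [_ Eu] hu; have [|TX TXC] := TC (rstar_n u).
    by split; [exact: dstar_measurable | rewrite absE].
  have Th t : (0 < t)%R -> T_Phi R n Phi (rstar_n u) t = h t.
    move=> t0; rewrite (hu t t0) /T_Phi /K3_fun.
    apply: (eq_supop_dstarstar n Phi _ t0) => s s0.
    by apply: rstar_dstar s0; exact: lebesgue_n_le.
  have [hX <-] := in_space_eq riX Th TX.
  by split=> //; rewrite /normE_n -[X in rhoE X]absE.
split; first by have [] := key v Ev hv.
rewrite -lee_pdivrMl//; apply: le_ereal_inf_tmp => _ [u [Eu hu] <-].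
rewrite lee_pdivrMl//; apply: (key u Eu _).2 => t t0.
by rewrite hu.
Qed.

Lemma T_Phi_bounded_of_K3_embeds : (0 < n)%N ->
  K3_embeds R n rhoE rhoX Phi -> T_Phi_bounded R n rhoE rhoX Phi.
Proof.
(* A positive dimension leaves a last coordinate to carry the variable of the rearrangement. *)
case: n => // m _ [C [C0 KC]]; exists C; split=> // f [mf Ef].
have [_ [_ [_ [_ [rhoE_le [_ [_ [_ rhoE_ri]]]]]]]] := riE.
have [u [mu uE]] : exists u : 'rV[R]_m.+1 -> \bar R,
    Lmeasurable_fun R m.+1 u /\ rstar_n u = rstar (rstar f).
  apply: equimeasurable_on_Rn; last exact: dstar_ge0.
  by move=> s t _; exact: dstar_nonincreasing.
have uf t : (0 < t)%R -> rstar_n u t = rstar f t.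
  by move=> t0; rewrite uE; apply: rstar_dstar t0; exact: le_lebesgue_measure.
(* [rstar_n u] and [f] have the same rearrangement on the positive half-line, so rearrangement
   invariance compares their norms. *)
have normE_le : normE_n R m.+1 rhoE u <= rhoE (abse \o f).
  apply: rhoE_ri; first exact: mplus_dstar.
    by split=> [|x _ /=]; [exact: measurableT_comp | exact: abse_ge0].
  move=> t t0; have -> : rstar (rstar_n u) t = rstar_n u t.
    by apply: rstar_dstar t0; exact: lebesgue_n_le.
  rewrite (uf t t0) /rstar.
  by rewrite (@eq_dstar _ _ _ _ f (abse \o f))// => x /=; rewrite abse_id.
have Eu : in_E_n R m.+1 rhoE u by split=> //; exact: le_lt_trans Ef.
have [KX KXC] : in_space R rhoX (K3_fun R m.+1 Phi u) /\
    rhoX (abse \o K3_fun R m.+1 Phi u) <= C%:E * rhoE (abse \o f).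
  have [|KX KXC] := KC (K3_fun R m.+1 Phi u); first by exists u.
  (* [u] itself competes in the infimum defining [rho_K3], so that infimum is at most the norm of
     [f]. *)
  split=> //; apply: le_trans KXC _; rewrite -lee_pdivlMl// muleA -EFinM.
  rewrite mulVf ?gt_eqF// mul1e; apply: le_trans normE_le.
  by apply: ereal_inf_lbound; exists u.
have KT t : (0 < t)%R -> K3_fun R m.+1 Phi u t = T_Phi R m.+1 Phi f t.
  exact: eq_supop_dstarstar.
by have [TX <-] := in_space_eq riX KT KX.
Qed.

End Bounded.

Theorem theorem4p2 (R : realType) (n : nat) (rhoE rhoX : (R -> \bar R) -> \bar R)
    (Phi : R -> R) :
  (0 < n)%N ->
  is_ri_function_norm R rhoE -> is_ri_function_norm R rhoX ->
  B_n_infty R n Phi ->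
  (K3_embeds R n rhoE rhoX Phi <-> T_Phi_bounded R n rhoE rhoX Phi).
Proof.
move=> n0 riE riX _; split; first exact: T_Phi_bounded_of_K3_embeds.
exact: K3_embeds_of_T_Phi_bounded.
Qed.
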